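(* Let $\llbracket\,\cdot\,\rrbracket:\mathbb{R}\to\mathbb{Z}$ be any function such that, setting $\eta(x)=|x-\llbracket x\rrbracket|$, the following hold: (C1) $\eta(x)=\eta(x+1)$ for all $x\in\mathbb{R}$; (C2) $\eta(x)=0$ for all $x\in\mathbb{Z}$; (C3) $\eta(nx)\leq n\,\eta(x)$ for all $x\in\mathbb{R}$ and $n\in\mathbb{N}$; (C4) for all $t>0$, the set $\eta^{-1}([0,t])\cap[0,1)$ is Jordan measurable and has positive measure. Let $K, r\in\mathbb{N}$. For every $j\in\{1,\dots,K\}$, let $f_j:\mathbb{R}^r\to\mathbb{R}$ be a non-zero homogeneous polynomial with coefficients in $\mathbb{Z}$. Assume that there exists $(x_1,\ldots,x_r)\in\mathbb{N}^r$ such that $f_j(x_1,\ldots,x_r)=0$ for all $j\in\{1,\dots,K\}$. Then for all $\alpha\in\mathbb{R}$, $$\liminf_{N\to\infty}\frac1N\,\#\bigl\{n\in\{1,\dots,N\} : \llbracket\alpha f_j\rrbracket(nx_1,\ldots,nx_r)=0\ \text{for all } j\in\{1,\dots,K\}\bigr\}>0.$$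
   Context: $\mathbb{N}$ is the set of positive integers. For a homogeneous polynomial of degree $d$ with integer coefficients, $$f(x_1,\ldots,x_r)=\sum_{\substack{\nu_1,\ldots,\nu_r\geq0\\ \nu_1+\cdots+\nu_r=d}}a_{\nu_1,\ldots,\nu_r}x_1^{\nu_1}\cdots x_r^{\nu_r},\qquad a_{\nu_1,\ldots,\nu_r}\in\mathbb{Z},$$ and $\alpha\in\mathbb{R}$, $(x_1,\dots,x_r)\in\mathbb{R}^r$, one defines $$\llbracket\alpha f\rrbracket(x_1,\ldots,x_r)=\sum_{\substack{\nu_1,\ldots,\nu_r\geq0\\ \nu_1+\cdots+\nu_r=d}}a_{\nu_1,\ldots,\nu_r}\,\llbracket\alpha x_1^{\nu_1}\cdots x_r^{\nu_r}\rrbracket.$$ *)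

(* Defs.v *)
(* MathComp-Analysis, with {mpoly int[r]} from multinomials (imported
   without its notations, which are incompatible with those of the analysis
   library). *)
From mathcomp Require Import all_boot all_order all_algebra.
From mathcomp Require Import all_classical all_reals all_analysis.
From mathcomp Require mpoly.
Import -(notations) mpoly.

Set Implicit Arguments.
Unset Strict Implicit.
Unset Printing Implicit Defensive.
Import Order.TTheory GRing.Theory Num.Theory.
Import numFieldNormedType.Exports.

Local Open Scope classical_set_scope.
Local Open Scope ring_scope.

Notation "{ 'mpoly' T [ n ] }" := (mpoly.mpoly n T)
  (at level 0, T, n at level 2, format "{ 'mpoly'  T [ n ] }") : type_scope.

Definition homogeneous (r : nat) (d : nat) (f : {mpoly int[r]}) : Prop :=
  f \is ishomog1 d (@mdeg r).

Section Bracket.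
Variables (R : realType) (br : R -> int).

Definition eta (x : R) : R := `|x - (br x)%:~R|.

Definition eta_sublevel (t : R) : set R := eta @^-1` `[0, t] `&` `[0, 1[.

(* The sum runs over the support of f, i.e. over the multi-indices m with a
   nonzero coefficient; all the other terms vanish. *)
Definition brmul (r : nat) (alpha : R) (f : {mpoly int[r]})
    (x : 'I_r -> R) : int :=
  \sum_(m <- msupp f)
     mcoeff m f * br (alpha * \prod_(i < r) x i ^+ m i).

End Bracket.

Section Jordan.
Variable R : realType.
Local Open Scope ereal_scope.

Definition elementary (E : set R) : Prop :=
  bounded_set E /\
  exists s : seq (interval R), E = \big[setU/set0]_(I <- s) [set` I].

(* On elementary sets the Lebesgue measure is the elementary content (the total
   length of any decomposition into disjoint intervals). *)
Definition jordan_inner (A : set R) : \bar R :=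
  ereal_sup [set lebesgue_measure E | E in [set E | elementary E /\ E `<=` A]].

Definition jordan_outer (A : set R) : \bar R :=
  ereal_inf [set lebesgue_measure E | E in [set E | elementary E /\ A `<=` E]].

Definition jordan_measurable (A : set R) : Prop :=
  bounded_set A /\ jordan_inner A = jordan_outer A.

(* Meaningful for Jordan measurable sets, where both contents agree. *)
Definition jordan_measure (A : set R) : \bar R := jordan_outer A.

End Jordan.

(* Main.v *)
(* If eta (alpha n^d) is small enough, then (C3) bounds every eta (alpha (nx)^m),
   so the bracket sum is an integer at distance < 1 from alpha n^d f(x) = 0. It
   remains to find a positive lower density of n with all the eta (alpha n^d)
   small. For rational alpha, multiples of the denominator do (C2). For
   irrational alpha, (C4) provides an interval ]a, b[ of [0, 1[ on which eta is
   small, and Weyl's theorem shows that (alpha n, ..., alpha n^D) mod 1 lies in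
   ]a, b[^D with positive lower density: the nonnegative trigonometric
   polynomial prod_d cos^(2M) (pi (alpha n^d - c)), with c the midpoint of
   ]a, b[, is at most rho^M < 1 outside of the box, while its average tends to
   (binomial(2M, M) / 4^M)^D >= (2M + 1)^-D, which is larger for M large. *)

Require Import Defs.
From mathcomp Require Import all_boot all_order all_algebra.
From mathcomp Require Import all_classical all_reals all_analysis.
From mathcomp Require mpoly.
Import -(notations) mpoly.
From mathcomp Require Import ring lra zify.

Set Implicit Arguments.
Unset Strict Implicit.
Unset Printing Implicit Defensive.
Import Order.TTheory GRing.Theory Num.Theory.
Import numFieldNormedType.Exports.

Local Open Scope classical_set_scope.
Local Open Scope ring_scope.

(** * Cesàro means and van der Corput differencing *)

Section Mean.
Variable R : realType.
Implicit Types (u v : nat -> R) (l : R).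

Definition mean u (N : nat) : R := (\sum_(n < N) u n) / N%:R.

Lemma eq_mean u v : u =1 v -> mean u = mean v.
Proof. by move=> /funext->. Qed.

Lemma mean_sum (I : Type) (s : seq I) (F : I -> nat -> R) N :
  mean (fun n => \sum_(i <- s) F i n) N = \sum_(i <- s) mean (F i) N.
Proof. by rewrite /mean exchange_big/= mulr_suml. Qed.

Lemma meanZ (a : R) u N : mean (fun n => a * u n) N = a * mean u N.
Proof. by rewrite /mean -mulr_sumr mulrA. Qed.

Lemma meanB u v N : mean (fun n => u n - v n) N = mean u N - mean v N.
Proof. by rewrite /mean sumrB mulrBl. Qed.

Lemma ler_mean u v N : (forall n, u n <= v n) -> mean u N <= mean v N.
Proof. by move=> uv; rewrite ler_wpM2r ?invr_ge0// ler_sum. Qed.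

Lemma mean_cst (a : R) N : (0 < N)%N -> mean (fun=> a) N = a.
Proof.
move=> N0; rewrite /mean sumr_const card_ord -[a *+ _]mulr_natr mulfK//.
by rewrite pnatr_eq0 -lt0n.
Qed.

Lemma cvg_mean_cst (a : R) : mean (fun=> a) @ \oo --> a.
Proof.
apply/cvgrPdist_lt => e e0; near=> N; rewrite mean_cst ?subrr ?normr0//.
by near: N; exists 1%N.
Unshelve. all: by end_near. Qed.

Lemma cvg_sum_seq (I : Type) (s : seq I) (F : I -> nat -> R) (l : I -> R) :
  (forall i, F i @ \oo --> l i) ->
  (fun N => \sum_(i <- s) F i N) @ \oo --> \sum_(i <- s) l i.
Proof.
move=> Fl; elim: s => [|i s IHs].
  by rewrite big_nil; under eq_fun do rewrite big_nil; exact: cvg_cst.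
by rewrite big_cons; under eq_fun do rewrite big_cons; apply: cvgD.
Qed.

Lemma cvg_mean_sum (I : Type) (s : seq I) (F : I -> nat -> R) (l : I -> R) :
  (forall i, mean (F i) @ \oo --> l i) ->
  mean (fun n => \sum_(i <- s) F i n) @ \oo --> \sum_(i <- s) l i.
Proof.
by move=> Fl; rewrite (funext (mean_sum s F)); exact: cvg_sum_seq.
Qed.

Lemma cvg_meanZ (a : R) u l :
  mean u @ \oo --> l -> mean (fun n => a * u n) @ \oo --> a * l.
Proof. by move=> ul; rewrite (funext (meanZ a u)); exact: cvgMr. Qed.

Lemma cvg_bounded_div u (B : R) : (forall n, `|u n| <= B) ->
  (fun N => u N / N%:R) @ \oo --> (0 : R).
Proof.
move=> uB; have B0 : 0 <= B by exact: le_trans (uB 0%N).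
apply/cvgr0Pnorm_lt => e e0; near=> N.
have N0 : (0 < N)%N by near: N; exists 1%N.
rewrite normrM normfV normr_nat ltr_pdivrMr ?ltr0n//.
apply: le_lt_trans (uB _) _; rewrite mulrC -ltr_pdivrMr//.
near: N; exact: nbhs_infty_gtr.
Unshelve. all: by end_near. Qed.

(** The difference of the two means telescopes to [(u N - u 0) / N]. *)
Lemma mean_shift1 u (B : R) : (forall n, `|u n| <= B) ->
  (fun N => mean (fun n => u n.+1) N - mean u N) @ \oo --> (0 : R).
Proof.
move=> uB; suff -> : (fun N => mean (fun n => u n.+1) N - mean u N) =
    (fun N => (u N - u 0%N) / N%:R).
  apply: (@cvg_bounded_div (fun N => u N - u 0%N) (B + B)) => n.
  by apply: le_trans (ler_normB _ _) _; exact: lerD.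
apply/funext => N; rewrite -mulrBl -sumrB -(telescope_sumr u (leq0n N)).
by rewrite big_mkord.
Qed.

Lemma mean_shift u (B : R) h : (forall n, `|u n| <= B) ->
  (fun N => mean (fun n => u (n + h)%N) N - mean u N) @ \oo --> (0 : R).
Proof.
elim: h u => [|h IHh] u uB.
  under eq_fun => N.
    under eq_mean do rewrite addn0.
    rewrite subrr; over.
  exact: cvg_cst.
rewrite -[X in _ --> X]addr0 (_ : (fun N => _) =
    (fun N => mean (fun n => u (n + h).+1) N - mean (fun n => u n.+1) N) +
    (fun N => mean (fun n => u n.+1) N - mean u N)).
  apply: cvgD; first exact: (IHh (fun n => u n.+1)).
  exact: mean_shift1 uB.
apply/funext => N; rewrite fctE subrKA; congr (mean _ _ - _).
by apply/funext => n; rewrite addnS.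
Qed.

(** The variance of [u] on the first [N] indices is nonnegative. *)
Lemma sqr_mean_le u N : mean u N ^+ 2 <= mean (fun n => u n ^+ 2) N.
Proof.
case: N => [|N]; first by rewrite /mean !big_ord0 !mul0r expr0n.
have : 0 <= mean (fun n => (u n - mean u N.+1) ^+ 2) N.+1.
  by rewrite divr_ge0// sumr_ge0// => i _; exact: sqr_ge0.
rewrite [X in 0 <= X](_ : _ = mean (fun n => u n ^+ 2) N.+1 - mean u N.+1 ^+ 2).
  by rewrite subr_ge0.
set m := mean u N.+1.
under eq_mean => n.
  rewrite (_ : (u n - m) ^+ 2 = u n ^+ 2 - ((2 * m) * u n - m ^+ 2)); last ring.
  over.
rewrite meanB meanB meanZ mean_cst// -/m; ring.
Qed.

(* The averages of [u] and of its window sums [n |-> sum_(h < H) u (n + h)] are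
   asymptotically proportional, and by Cauchy-Schwarz the latter are controlled
   by the correlations, whose off-diagonal terms vanish in the limit. *)
Lemma van_der_corput (a : nat -> R) :
  (forall h k, h != k ->
     mean (fun n => cos (a (n + h)%N - a (n + k)%N)) @ \oo --> (0 : R)) ->
  mean (fun n => cos (a n)) @ \oo --> (0 : R).
Proof.
move=> a_corr; apply/cvgr0Pnorm_lt => e e0.
(* With [m] the mean of the cosines, the estimates below give [(H m)^2 < 2 (H + 1) + 2 <= 6 H], so
   [H > 6 / e^2] forces [|m| < e]. *)
pose H := (Num.truncn (6 / e ^+ 2)).+1.
have HE : 6 / e ^+ 2 < H%:R by exact: truncnS_gt.
have H0 : 0 < H%:R :> R by rewrite ltr0n.
pose c n := \sum_(h < H) cos (a (n + h)%N).
pose s n := \sum_(h < H) sin (a (n + h)%N).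
(* This is the squared modulus of a window sum of [exp (i a)]. On average only the [H] diagonal
   terms [h = k] survive. *)
have cs n : c n ^+ 2 + s n ^+ 2 =
    \sum_(h < H) \sum_(k < H) cos (a (n + h)%N - a (n + k)%N).
  rewrite !expr2 /c /s !mulr_suml -big_split/=; apply: eq_bigr => h _.
  by rewrite !mulr_sumr -big_split/=; apply: eq_bigr => k _; rewrite cosB.
have cvg_cs : mean (fun n => c n ^+ 2 + s n ^+ 2) @ \oo --> (H%:R : R).
  rewrite (eq_mean cs).
  rewrite [X in _ --> X](_ : _ = \sum_(h < H) \sum_(k < H) (h == k)%:R).
    apply: cvg_mean_sum => h; apply: cvg_mean_sum => k.
    have [<-|hk] := eqVneq h k; last exact: a_corr.
    by under eq_mean do rewrite subrr cos0; exact: cvg_mean_cst.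
  rewrite -[in LHS](card_ord H) -sum1_card natr_sum; apply: eq_bigr => h _.
  rewrite (bigD1 h)//= eqxx big1 ?addr0// => k kh.
  by rewrite eq_sym (negbTE kh).
have cvg_c : (fun N => mean c N - H%:R * mean (fun n => cos (a n)) N) @ \oo
    --> (0 : R).
  rewrite [X in X @ _](_ : _ = fun N => \sum_(h < H)
      (mean (fun n => cos (a (n + h)%N)) N - mean (fun n => cos (a n)) N)).
    rewrite [X in _ --> X](_ : _ = \sum_(h < H) 0); last by rewrite big1.
    apply: cvg_sum_seq => h.
    by apply: (@mean_shift (fun n => cos (a n)) 1) => n; exact: cos_max.
  apply/funext => N; rewrite sumrB mean_sum sumr_const card_ord.
  by rewrite mulr_natl.
near=> N.
have wN : `|mean c N - H%:R * mean (fun n => cos (a n)) N| < 1.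
  by near: N; move/cvgr0Pnorm_lt : cvg_c; exact.
have zN : `|H%:R - mean (fun n => c n ^+ 2 + s n ^+ 2) N| < 1.
  by near: N; move/cvgrPdist_lt : cvg_cs; exact.
have cN : mean c N ^+ 2 <= mean (fun n => c n ^+ 2 + s n ^+ 2) N.
  apply: le_trans (sqr_mean_le _ _) _; apply: ler_mean => n.
  by rewrite lerDl sqr_ge0.
move: wN zN cN; set w := mean c N; set m := mean (fun n => cos (a n)) N.
set z := mean _ N.
rewrite !ltr_norml => /andP[w1 w2] /andP[z1 z2] cN.
have H1 : 1 <= H%:R :> R by rewrite ler1n.
move: (H%:R : R) HE H0 H1 w1 w2 z1 z2 => h HE H0 H1 w1 w2 z1 z2.
have Hm : (h * m) ^+ 2 < 6 * h.
  have wd : (w - h * m) ^+ 2 < 1.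
    rewrite -subr_gt0 [ltRHS](_ : _ =
      (1 - (w - h * m)) * (1 + (w - h * m))); last ring.
    by apply: mulr_gt0; lra.
  have : (h * m) ^+ 2 <= 2 * w ^+ 2 + 2 * (w - h * m) ^+ 2.
    rewrite -subr_ge0.
    rewrite (_ : _ - _ = (2 * w - h * m) ^+ 2); last ring.
    exact: sqr_ge0.
  lra.
have {}Hm : h * m ^+ 2 < 6.
  by rewrite -(ltr_pM2l H0); move: Hm; rewrite exprMn expr2 -mulrA [6 * _]mulrC.
have : m ^+ 2 < e ^+ 2.
  rewrite -(ltr_pM2l H0); apply: lt_trans Hm _.
  by rewrite -ltr_pdivrMr ?exprn_gt0.
rewrite -(real_normK (num_real m)) ltr_sqr ?nnegrE ?(ltW e0)// ltr_norml.
Unshelve. all: by end_near. Qed.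

End Mean.

(** * Weyl's theorem for polynomial phases with irrational leading coefficient *)

Section Weyl.
Variable R : realType.
Implicit Types (x a : R) (Q : {poly R}).

Lemma irrationalM (k : int) a :
  k != 0 -> irrational a -> irrational (k%:~R * a).
Proof.
move=> k0 aI [q _ qE]; apply: aI; exists (q / k%:~R) => //.
by rewrite fmorph_div/= ratr_int qE mulrAC mulfV ?mul1r// intr_eq0.
Qed.

(** Squaring removes the sign [(-1)^k]. Even powers of these cosines therefore depend only on [x]
    mod 1. *)
Lemma sqr_cosDint x (k : int) : cos (pi * (x + k%:~R)) ^+ 2 = cos (pi * x) ^+ 2.
Proof.
have nat_case (n : nat) (y : R) : cos (pi * (y + n%:R)) ^+ 2 = cos (pi * y) ^+ 2.
  elim: n => [|n IHn]; first by rewrite addr0.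
  by rewrite -natr1 addrA mulrDr mulr1 cosDpi sqrrN.
case: k => n; first exact: nat_case.
by rewrite -(nat_case n.+1) NegzE mulrNz subrK.
Qed.

Lemma sin_pi_irrational_neq0 a : irrational a -> sin (pi * a) != 0.
Proof.
move=> aI; rewrite -sqrf_eq0 sin2cos2.
pose t := a - (Num.floor a)%:~R.
have [t0 t1] : 0 <= t /\ t < 1.
  rewrite /t subr_ge0 ltrBlDl; split; first exact: floor_le_tmp.
  by have /andP[_] := floor_itv a; rewrite intrD.
have {}t0 : 0 < t.
  rewrite lt_neqAle t0 andbT eq_sym subr_eq0; apply/eqP => aE; apply: aI.
  by exists (Num.floor a)%:~R => //; rewrite ratr_int.
have -> : a = t + (Num.floor a)%:~R by rewrite subrK.
rewrite sqr_cosDint -sin2cos2 sqrf_eq0 gt_eqF// sin_gt0_pi//.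
by rewrite mulr_gt0 ?pi_gt0//= gtr_pMr ?pi_gt0.
Qed.

Definition irrational_lead (e : nat) Q :=
  (size Q <= e.+1)%N /\ irrational Q`_e.

(** Weyl differencing: the top terms cancel and the new leading coefficient is [(h - k) (e + 1)]
    times that of [Q], a nonzero integer multiple of an irrational. *)
Lemma irrational_lead_shiftB e Q (h k : nat) : h != k ->
  irrational_lead e.+1 Q ->
  exists2 P : {poly R}, irrational_lead e P &
    forall x, P.[x] = Q.[x + h%:R] - Q.[x + k%:R].
Proof.
move=> hk [sQ Qe].
(* Taylor expansion of [Q] at [x] with increments [h] and [k], in terms of the derivatives divided
   by [i!]. The term [i = 0] vanishes and [i = 1] alone reaches degree [e]. *)
exists (\sum_(i < e.+2) (h%:R ^+ i - k%:R ^+ i) *: Q^`N(i)); last first.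
  move=> x; rewrite !(nderiv_taylor_wide _ sQ); try exact: mulrC.
  rewrite -sumrB horner_sum; apply: eq_bigr => i _.
  by rewrite hornerZ mulrBl ![_ * Q^`N(i).[x]]mulrC.
have Q0 i : (e.+1 < i)%N -> Q`_i = 0 by move/leq_sizeP : sQ; apply.
split.
  apply/leq_sizeP => j ej; rewrite coef_sum big1// => -[[|i] ilt] _ /=.
    by rewrite !expr0 subrr scale0r coef0.
  rewrite coefZ coef_nderivn Q0 ?mul0rn ?mulr0//.
  by rewrite addSn ltnS (leq_trans ej)// leq_addl.
rewrite coef_sum big_ord_recl big_ord_recl/= !expr0 subrr scale0r coef0 add0r.
rewrite big1 ?addr0; last first.
  move=> i _; rewrite coefZ coef_nderivn Q0 ?mul0rn ?mulr0//.
  by rewrite !addSn ltnS ltnS leq_addl.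
rewrite coefZ coef_nderivn !expr1 add1n bin1 -[_`__ *+ _]mulr_natl mulrA.
rewrite [_ * e.+1%:R](_ : _ = ((h%:Z - k%:Z) * e.+1%:Z)%:~R).
  by apply: irrationalM => //; rewrite mulf_neq0// subr_eq0 eqz_nat.
by rewrite rmorphM rmorphB.
Qed.

Lemma weyl_linear Q : irrational_lead 1 Q ->
  mean (fun n => cos (2 * pi * Q.[n.+1%:R])) @ \oo --> (0 : R).
Proof.
move=> [sQ Q1]; set a := Q`_1 in Q1; set b := Q`_0.
have sina := sin_pi_irrational_neq0 Q1.
have QE x : Q.[x] = a * x + b.
  rewrite (horner_coef_wide _ sQ) big_ord_recl big_ord1 /= expr0 expr1 mulr1.
  by rewrite addrC.
(* A discrete primitive of the cosine, bounded because [sin (pi * a)] is nonzero; the sum then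
   telescopes. *)
pose u n := sin (2 * pi * (a * n.+1%:R + b) - pi * a) / (2 * sin (pi * a)).
have uE n : cos (2 * pi * Q.[n.+1%:R]) = u n.+1 - u n.
  rewrite /u -mulrBl QE.
  rewrite (_ : 2 * pi * (a * n.+2%:R + b) - pi * a =
    2 * pi * (a * n.+1%:R + b) + pi * a); last by rewrite -[n.+2%:R]natr1; ring.
  by rewrite sinD sinB; field.
rewrite (eq_mean uE) (_ : mean _ = fun N => (u N - u 0%N) / N%:R); last first.
  by apply/funext => N; rewrite /mean -(telescope_sumr u (leq0n N)) big_mkord.
pose B := `|(2 * sin (pi * a))^-1|.
have uB n : `|u n| <= B.
  by rewrite /u normrM ler_piMl// sin_max.
apply: (@cvg_bounded_div _ (fun N => u N - u 0%N) (B + B)) => n.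
by apply: le_trans (ler_normB _ _) _; exact: lerD.
Qed.

(** Induction on the degree: the correlations required by van der Corput are cosines of polynomials
    of degree one less. *)
Lemma weyl e Q : irrational_lead e.+1 Q ->
  mean (fun n => cos (2 * pi * Q.[n.+1%:R])) @ \oo --> (0 : R).
Proof.
elim: e Q => [|e IHe] Q; first exact: weyl_linear.
move=> Qe; apply: (van_der_corput (a := fun n => 2 * pi * Q.[n.+1%:R])) => h k hk.
have [P Pe PE] := irrational_lead_shiftB hk Qe.
rewrite (eq_mean (v := fun n => cos (2 * pi * P.[n.+1%:R]))); first exact: IHe.
by move=> n; rewrite PE mulrBr -!addSn !natrD.
Qed.

(** Binomial expansion of [((exp (i t) + exp (- i t)) / 2)^n], in real form. It turns a power in the
    weight into a combination of pure cosines; the induction is Pascal's rule. *)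
Lemma exp_cosM_cos n (t y : R) :
  cos t ^+ n * cos y = 2 ^- n *
    \sum_(k < n.+1) 'C(n, k)%:R * cos (y + (n%:R - 2 * k%:R) * t).
Proof.
elim: n y => [|n IHn] y.
  by rewrite big_ord1 bin0 mulr0 subrr mul0r addr0 !expr0 invr1 !mul1r.
have -> : cos t ^+ n.+1 * cos y =
    2^-1 * (cos t ^+ n * cos (y + t) + cos t ^+ n * cos (y - t)).
  by rewrite cosD cosB exprS; field.
rewrite !IHn -mulrDr mulrA -invfM -exprS; congr (_ * _).
rewrite [RHS]big_ord_recl/= bin0.
under [X in _ = _ + X]eq_bigr do rewrite binS natrD mulrDl.
rewrite big_split/= addrA; congr (_ + _); last first.
  apply: eq_bigr => k _; congr (_ * cos _).
  by rewrite /bump/= add1n -!natr1; ring.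
transitivity (\sum_(k < n.+2)
    'C(n, k)%:R * cos (y + (n.+1%:R - 2 * k%:R) * t)); last first.
  by rewrite big_ord_recl/= bin0.
rewrite [RHS]big_ord_recr/= bin_small// mul0r addr0; apply: eq_bigr => k _.
by congr (_ * cos _); rewrite -natr1; ring.
Qed.

End Weyl.

(** * Averages of the trigonometric weight *)

Section TestFunction.
Variables (R : realType) (alpha c : R) (M : nat).

(* As a function of each [alpha * n ^ d] mod 1, this is a nonnegative
   trigonometric polynomial that peaks at [c]. *)
Definition cos_weight (D n : nat) : R :=
  \prod_(d < D) cos (pi * (alpha * n.+1%:R ^+ d.+1 - c)) ^+ (2 * M).

(** The phase that replaces [Q] when the last factor of the weight is expanded: the frequency
    [2 M - 2 k] times [pi] is [2 pi] times [M - k]. *)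
Let tilt (D k : nat) (Q : {poly R}) :=
  Q + (M%:R - k%:R) *: (alpha *: 'X^(D.+1) - c%:P).

Let cos_weight_step D Q n :
  cos_weight D.+1 n * cos (2 * pi * Q.[n.+1%:R]) =
  \sum_(k < (2 * M).+1) (2 ^- (2 * M) * 'C(2 * M, k)%:R) *
    (cos_weight D n * cos (2 * pi * (tilt D k Q).[n.+1%:R])).
Proof.
rewrite /cos_weight big_ord_recr/= -mulrA exp_cosM_cos mulrA mulr_sumr.
apply: eq_bigr => k _; rewrite -!mulrA mulrCA; congr (_ * _).
rewrite mulrCA; congr (_ * (_ * cos _)).
by rewrite /tilt !(hornerD, hornerZ, hornerN, hornerXn, hornerC) natrM; ring.
Qed.

Let coef_tilt D k Q j : (tilt D k Q)`_j =
  Q`_j + (M%:R - k%:R) * (alpha * (j == D.+1)%:R - (if j == 0%N then c else 0)).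
Proof. by rewrite /tilt !coefE. Qed.

Let irrational_lead_tilt D k e Q : (D.+1 < e)%N ->
  irrational_lead e Q -> irrational_lead e (tilt D k Q).
Proof.
move=> De [sQ Qe].
have coefE j : (e <= j)%N -> (tilt D k Q)`_j = Q`_j.
  move=> ej; have j0 : (D.+1 < j)%N := leq_trans De ej.
  rewrite coef_tilt gtn_eqF// gtn_eqF ?(leq_trans _ j0)//.
  by rewrite mulr0 subrr mulr0 addr0.
split; last by rewrite coefE.
apply/leq_sizeP => j ej; rewrite coefE ?(ltnW ej)//.
by move/leq_sizeP : sQ; apply.
Qed.

Let irrational_lead_tilt0 D (k : nat) : irrational alpha -> k != M ->
  irrational_lead D.+1 (tilt D k 0).
Proof.
move=> alphaI kM; split.
  apply/leq_sizeP => j Dj; rewrite coef_tilt coef0 add0r gtn_eqF// gtn_eqF.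
    by rewrite mulr0 subrr mulr0.
  exact: leq_trans Dj.
rewrite coef_tilt coef0 add0r eqxx mulr1 subr0.
rewrite (_ : M%:R - k%:R = (M%:Z - k%:Z)%:~R); last by rewrite rmorphB.
by apply: irrationalM => //; rewrite subr_eq0 eqz_nat eq_sym.
Qed.

Hypothesis alphaI : irrational alpha.

(** Expanding the factors one by one perturbs only coefficients of degree at most [D < e], so the
    irrational leading coefficient survives until Weyl's theorem applies. *)
Lemma mean_cos_weight_cos D e Q : (D < e)%N -> irrational_lead e Q ->
  mean (fun n => cos_weight D n * cos (2 * pi * Q.[n.+1%:R])) @ \oo --> (0 : R).
Proof.
elim: D e Q => [|D IHD] [//|e] Q De Qe.
  rewrite (eq_mean (v := fun n => cos (2 * pi * Q.[n.+1%:R]))).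
    exact: weyl Qe.
  by move=> n; rewrite /cos_weight big_ord0 mul1r.
rewrite (eq_mean (cos_weight_step D Q)).
rewrite [X in _ --> X](_ : _ =
    \sum_(k < (2 * M).+1) (2 ^- (2 * M) * 'C(2 * M, k)%:R) * 0); last first.
  by rewrite big1// => k _; rewrite mulr0.
apply: cvg_mean_sum => k; apply: cvg_meanZ; apply: IHD (ltnW De) _.
exact: irrational_lead_tilt.
Qed.

(** Expanding the last factor from the zero phase, every [k] other than [M] leaves a leading
    coefficient [(M - k) alpha], which is irrational, and averages to 0. The term [k = M] has zero
    phase and contributes the central binomial ratio. *)
Lemma mean_cos_weight D :
  mean (cos_weight D) @ \oo --> ((2 ^- (2 * M) * 'C(2 * M, M)%:R) ^+ D : R).
Proof.
elim: D => [|D IHD].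
  rewrite expr0 (eq_mean (v := fun=> 1)); first exact: cvg_mean_cst.
  by move=> n; rewrite /cos_weight big_ord0.
have step n := cos_weight_step D 0 n.
rewrite (eq_mean (v := fun n => cos_weight D.+1 n * cos (2 * pi * 0.[n.+1%:R]))).
  rewrite (eq_mean step).
  have MM : (M < (2 * M).+1)%N by rewrite ltnS leq_pmull.
  rewrite [X in _ --> X](_ : _ =
      \sum_(k < (2 * M).+1) (2 ^- (2 * M) * 'C(2 * M, k)%:R) *
        (if k == M :> nat then (2 ^- (2 * M) * 'C(2 * M, M)%:R) ^+ D else 0)).
    apply: cvg_mean_sum => k; apply: cvg_meanZ; case: ifPn => kM.
      rewrite (eq_mean (v := cos_weight D))// => n.
      by rewrite /tilt (eqP kM) subrr scale0r addr0 horner0 mulr0 cos0 mulr1.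
    apply: (@mean_cos_weight_cos _ D.+1) => //.
    exact: irrational_lead_tilt0.
  rewrite (bigD1 (Ordinal MM))//= eqxx big1 ?addr0; first by rewrite exprS.
  by move=> k kM; rewrite ifN ?mulr0.
by move=> n; rewrite horner0 mulr0 cos0 mulr1.
Qed.

End TestFunction.

(** * Peak average of the weight against its size away from the box *)

Lemma central_binomial_ge M : (4 ^ M <= (2 * M).+1 * 'C(2 * M, M))%N.
Proof.
elim: M => [//|M IHM].
(* The recurrence of central binomial coefficients; the induction closes since
   [2 (M + 1) <= 2 (M + 1) + 1]. *)
have E : (M.+1 * 'C(2 * M.+1, M.+1) = 2 * ((2 * M).+1 * 'C(2 * M, M)))%N.
  have sym : 'C((2 * M.+1).-1, M) = 'C((2 * M).+1, M.+1).
    rewrite -[RHS]bin_sub; last by rewrite ltnS leq_pmull.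
    by rewrite mulnS; congr 'C(_, _); lia.
  by rewrite -mul_bin_diag sym -mulnA -mul_bin_diag.
have := leq_mul (leqnn 4) IHM; rewrite -expnS => /leq_trans; apply.
rewrite -[4%N]/(2 * 2)%N -mulnA -E mulnA.
by rewrite leq_pmul2r ?bin_gt0 ?leq_pmull// !mul2n -!addnn; lia.
Qed.

Section BoxDensity.
Variable R : realType.
Implicit Types (x a b : R).

Lemma central_binomial_ratio_ge M :
  (2 * M).+1%:R^-1 <= 2 ^- (2 * M) * 'C(2 * M, M)%:R :> R.
Proof.
rewrite mulrC ler_pdivlMr ?exprn_gt0// mulrC ler_pdivrMr ?ltr0n//.
rewrite exprM -natrX -natrX -natrM ler_nat mulnC.
exact: central_binomial_ge.
Qed.

Lemma exp_lt_inv_poly (rho : R) D : 0 < rho < 1 ->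
  exists M : nat, rho ^+ M < (2 * M).+1%:R^-1 ^+ D.
Proof.
move=> /andP[rho0 rho1]; pose l := - ln rho.
have l0 : 0 < l by rewrite oppr_gt0 ln_lt0// rho0.
(* Since [rho^M = exp (- M l)], it suffices that [(M l)^(D+1) / (D+1)!], a lower bound of
   [exp (M l)], be at least [(3 M)^D >= (2 M + 1)^D]. *)
pose M := (Num.truncn ((3 ^ D * D.+1`!)%:R / l ^+ D.+1)).+1.
have Ml : (3 ^ D * D.+1`!)%:R < M%:R * l ^+ D.+1.
  by rewrite -ltr_pdivrMr ?exprn_gt0//; exact: truncnS_gt.
exists M; have -> : rho ^+ M = (expR (M%:R * l))^-1.
  by rewrite expRM_natl /l expRN lnK ?posrE// exprVn invrK.
rewrite exprVn ltf_pV2 ?posrE ?expR_gt0 ?exprn_gt0 ?ltr0n//.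
apply: lt_le_trans (expR_ge1Dxn D _); last by rewrite mulr_ge0// ltW.
rewrite ltr_pwDl// ler_pdivlMr ?ltr0n ?fact_gt0//.
apply: (@le_trans _ _ ((3 * M)%:R ^+ D * D.+1`!%:R)).
  by rewrite ler_wpM2r// lerXn2r ?nnegrE// ler_nat /M; lia.
rewrite natrM !exprMn mulrAC -natrX -natrM [M%:R ^+ D.+1]exprS -mulrA.
by rewrite [M%:R * _]mulrCA mulrC ler_wpM2l ?exprn_ge0 ?ltW//.
Qed.

Lemma sqr_cos_away a b x : 0 <= a -> a < b -> b < 1 -> 0 <= x < 1 ->
  ~~ (a < x < b) ->
  cos (pi * (x - (a + b) / 2)) ^+ 2 <= cos (pi * ((b - a) / 2)) ^+ 2.
Proof.
move=> a0 ab b1 /andP[x0 x1] xab.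
set w := (b - a) / 2; set y := x - (a + b) / 2.
(* The upper bound, from [0 <= a] and [b < 1], keeps [x] at distance at least [w] from the other
   translates of the midpoint by integers, where the squared cosine peaks again. *)
have [wy yw] : w <= `|y| /\ `|y| <= 1 - w.
  move: xab; rewrite negb_and -!leNgt => /orP[xa|bx].
    by rewrite ler0_norm /w /y; [split; lra|lra].
  by rewrite ger0_norm /w /y; [split; lra|lra].
have -> : cos (pi * y) = cos (pi * `|y|).
  by rewrite -[LHS]cos_norm normrM (ger0_norm (pi_ge0 R)).
have pi0 := pi_gt0 R.
have w0 : 0 <= w by rewrite /w; lra.
have in_pi (z : R) : 0 <= z <= 1 -> pi * z \in `[0, pi].
  by move=> /andP[z0 z1]; rewrite in_itv/= mulr_ge0 ?(ltW pi0)//= ler_piMr// ltW.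
have cos_le (z t : R) : 0 <= z <= 1 -> 0 <= t <= 1 -> z <= t ->
    cos (pi * t) <= cos (pi * z).
  move=> z01 t01 zt; rewrite leNgt ltr_cos ?in_pi//.
  by rewrite -leNgt ler_pM2l.
have c1 : cos (pi * `|y|) <= cos (pi * w) by apply: cos_le => //; lra.
have c2 : - cos (pi * w) <= cos (pi * `|y|).
  rewrite (_ : - cos (pi * w) = cos (pi * (1 - w))); last first.
    by rewrite mulrBr mulr1 cosB cospi sinpi mul0r addr0 mulN1r.
  by apply: cos_le => //; lra.
rewrite -subr_ge0 [leRHS](_ : _ = (cos (pi * w) - cos (pi * `|y|)) *
  (cos (pi * w) + cos (pi * `|y|))); last ring.
by apply: mulr_ge0; lra.
Qed.

End BoxDensity.

(** * Sets of integers with positive lower density *)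

Section Density.
Variable R : realType.
Implicit Types (P : pred nat) (x c alpha a b : R).

Definition pos_lower_density P : Prop :=
  exists2 delta : R, 0 < delta &
    \forall N \near \oo, delta <= (count P (iota 1 N))%:R / N%:R.

(** Means run over [n < N] while the density counts from 1 to [N], whence [n.+1] throughout. *)
Lemma count_iota1 P N : count P (iota 1 N) = (\sum_(n < N) P n.+1)%N.
Proof.
rewrite -sum1_count big_mkcond/= (_ : iota 1 N = index_iota 1 N.+1); last first.
  by rewrite /index_iota subn1.
by rewrite big_add1 big_mkord; apply: eq_bigr => n _; case: (P _).
Qed.

Lemma limn_einf_gt0 P : pos_lower_density P ->
  (0 < limn_einf (fun N : nat =>
     ((count P (iota 1 N))%:R / N%:R : R)%:E))%E.
Proof.
move=> [delta delta0 [N0 _ dN]]; rewrite limn_einf_lim.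
apply: (@lt_le_trans _ _ delta%:E); first by rewrite lte_fin.
rewrite (cvg_lim _ (@cvg_einfs_sup _ _))//.
apply: (@le_trans _ _ (einfs (fun N : nat =>
  ((count P (iota 1 N))%:R / N%:R : R)%:E) N0)); last first.
  by apply: ereal_sup_ubound; exists N0.
apply: le_ereal_inf_tmp => _ [n /= N0n <-]; rewrite lee_fin; exact: dN.
Qed.

Lemma pos_lower_density_dvdn q P : (0 < q)%N ->
  (* The factor 2 in the bound below absorbs the rounding in [N %/ q] once [q <= N]. *)
  (forall n, (q %| n.+1)%N -> P n.+1) -> pos_lower_density P.
Proof.
move=> q0 qP; exists (2 * q)%:R^-1; first by rewrite invr_gt0 ltr0n muln_gt0.
near=> N; have qN : (q <= N)%N by near: N; exists q.
have N0 : (0 < N)%N := leq_trans q0 qN.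
rewrite ler_pdivlMr ?ltr0n// mulrC ler_pdivrMr ?ltr0n ?muln_gt0//.
rewrite -natrM ler_nat.
have : (N %/ q <= count P (iota 1 N))%N.
  rewrite count_iota1 divn_count_dvd big_add1/= big_mkord.
  by apply: leq_sum => n _; case: (boolP (q %| _)%N) => // /qP ->.
have : (0 < N %/ q)%N by rewrite divn_gt0.
have := divn_eq N q; have := ltn_pmod N q0.
by move: (count _ _) (N %/ q)%N (N %% q)%N => c k s; nia.
Unshelve. all: by end_near. Qed.

Definition fract (x : R) : R := x - (Num.floor x)%:~R.

Lemma fract_itv x : 0 <= fract x < 1.
Proof.
rewrite /fract subr_ge0 ltrBlDl floor_le_tmp/=.
by have /andP[_] := floor_itv x; rewrite intrD.
Qed.

Lemma sqr_cos_fract x c : cos (pi * (fract x - c)) ^+ 2 = cos (pi * (x - c)) ^+ 2.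
Proof.
rewrite -[RHS](_ : cos (pi * (fract x - c + (Num.floor x)%:~R)) ^+ 2 = _).
  by rewrite sqr_cosDint.
by congr (cos (pi * _) ^+ 2); rewrite /fract; ring.
Qed.

Lemma pos_lower_density_box alpha a b D P :
  irrational alpha -> 0 <= a -> a < b -> b < 1 ->
  (forall n, (forall d, (d < D)%N -> a < fract (alpha * n.+1%:R ^+ d.+1) < b) ->
     P n.+1) ->
  pos_lower_density P.
Proof.
move=> alphaI a0 ab b1 boxP.
pose c := (a + b) / 2; pose rho := cos (pi * ((b - a) / 2)) ^+ 2.
have pi0 := pi_gt0 R.
have w0 : 0 < pi * ((b - a) / 2) by apply: mulr_gt0 => //; lra.
have w1 : pi * ((b - a) / 2) < pi / 2 by rewrite ltr_pM2l; lra.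
have rho01 : 0 < rho < 1.
  rewrite exprn_gt0/= ?cos_gt0_pihalf ?w1 ?andbT//; last first.
    by apply: lt_trans w0; rewrite oppr_lt0 divr_gt0.
  by rewrite /rho cos2sin2 ltrBlDr ltrDl exprn_gt0// sin_gt0_pihalf// w0.
have [M MP] := exp_lt_inv_poly D rho01.
have /andP[rho0 rho1] := rho01.
pose z : R := (2 ^- (2 * M) * 'C(2 * M, M)%:R) ^+ D.
have zr : rho ^+ M < z.
  apply: lt_le_trans MP _.
  by rewrite lerXn2r ?nnegrE ?invr_ge0// ?central_binomial_ratio_ge//
    mulr_ge0// invr_ge0 exprn_ge0.
(* The weight has limiting mean [z] and exceeds the indicator of [P] by at most [rho ^+ M]. Half of
   the gap is spent on convergence, the other half is the density. *)
exists ((z - rho ^+ M) / 2); first by rewrite divr_gt0// subr_gt0.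
have wle n : cos_weight alpha c M D n <= (P n.+1)%:R + rho ^+ M.
  have term01 d : 0 <= cos (pi * (alpha * n.+1%:R ^+ d.+1 - c)) ^+ (2 * M) <= 1.
    rewrite exprM exprn_ge0 ?sqr_ge0//= exprn_ile1 ?sqr_ge0//.
  have [Pn|nPn] := boolP (P n.+1).
    apply: (@le_trans _ _ 1); first exact: prodr_ile1.
    by rewrite lerDl exprn_ge0// ltW.
  have /existsP[d dP] : [exists d : 'I_D,
      ~~ (a < fract (alpha * n.+1%:R ^+ d.+1) < b)].
    move: nPn; apply: contraR; rewrite negb_exists => /forallP box.
    by apply: boxP => d dD; have /negPn := box (Ordinal dD).
  (* The coordinate [d] lying outside the interval contributes at most [rho ^+ M], all the others at
     most 1. *)
  rewrite add0r /cos_weight (bigD1 d)//= -[leRHS]mulr1; apply: ler_pM => //.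
  - by have /andP[] := term01 d.
  - by apply: prodr_ge0 => i _; have /andP[] := term01 i.
  - rewrite exprM lerXn2r ?nnegrE ?sqr_ge0 ?(ltW rho0)//.
    by rewrite -sqr_cos_fract sqr_cos_away// fract_itv.
  - exact: prodr_ile1.
have := @mean_cos_weight _ alpha c M alphaI D; move/cvgrPdist_lt.
move=> /(_ ((z - rho ^+ M) / 2)); rewrite divr_gt0 ?subr_gt0// => /(_ isT) zlim.
near=> N; have N0 : (0 < N)%N by near: N; exists 1%N.
have zN : `|z - mean (cos_weight alpha c M D) N| < (z - rho ^+ M) / 2.
  by near: N; exact: zlim.
rewrite count_iota1 natr_sum.
have : mean (cos_weight alpha c M D) N <=
    mean (fun n => (P n.+1)%:R) N + rho ^+ M.
  rewrite -[X in _ + X](mean_cst _ N0) -mulrDl -big_split/=.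
  exact: (@ler_mean _ _ (fun n => (P n.+1)%:R + rho ^+ M)).
rewrite -/(mean (fun n => (P n.+1)%:R) N).
by move: zN; rewrite ltr_norml => /andP[_]; lra.
Unshelve. all: by end_near. Qed.

End Density.

(** * Intervals inside Jordan measurable sets *)

Section Jordan.
Variable R : realType.
Implicit Types A : set R.

(** The inner content is positive, so some elementary subset has positive measure; as a finite union
    of intervals, it has a member of positive length. *)
Lemma jordan_contains_itv A : jordan_measurable A ->
  (0 < jordan_measure A)%E -> exists a b : R, a < b /\ `]a, b[ `<=` A.
Proof.
move=> [_ AE]; rewrite /jordan_measure -AE => A0.
have [E [[_ [s sE]] EA] E0] : exists2 E : set R,
    elementary E /\ E `<=` A & (0 < lebesgue_measure E)%E.
  apply: contrapT => nE; move: A0; rewrite ltNge => /negP; apply.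
  apply: ge_ereal_sup => _ [E EP <-]; rewrite leNgt; apply/negP => E0.
  by apply: nE; exists E.
have sub (I : interval R) : I \in s -> [set` I] `<=` A.
  by move=> Is; apply: subset_trans EA; rewrite sE -bigcup_seq => y Iy; exists I.
have [I [Is I0]] : exists I, I \in s /\
    (0 < @lebesgue_measure R [set` I])%E.
  apply: contrapT => nI; suff : lebesgue_measure E = 0%E.
    by move=> E00; move: E0; rewrite E00 ltxx.
  rewrite sE.
  have {sE EA sub E0} : forall I, I \in s -> @lebesgue_measure R [set` I] = 0%E.
    move=> I Is; apply/eqP; rewrite eq_le measure_ge0 andbT leNgt.
    by apply/negP => I0; apply: nI; exists I.
  elim: s {nI} => [|I s IHs] s0; first by rewrite big_nil measure0.
  rewrite big_cons measureU0//.
  - exact: (s0 I (mem_head _ _)).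
  - by apply: bigsetU_measurable => J _; exact: measurable_itv.
  - by apply: IHs => J Js; apply: s0; rewrite in_cons Js orbT.
move: I0 (sub _ Is); rewrite lebesgue_measure_itv.
case: ifPn => [I12 _|_]; last by rewrite ltxx.
have itv_sub (a b : R) : a < b -> (forall y, a < y < b -> y \in I) ->
    [set` I] `<=` A -> exists a b : R, a < b /\ `]a, b[ `<=` A.
  move=> ab abI IA; exists a, b; split => // y; rewrite /= in_itv/= => yab.
  exact/IA/abI.
(* One case for each kind of endpoints. A half-line yields a unit interval at its finite end, the
   whole line yields []0, 1[]. *)
case: I I12 itv_sub {Is sub} => [[[] u|[]] [[] v|[]]]//=; rewrite ?lte_fin => uv sub;
  [apply: (sub u v)|apply: (sub u v)|apply: (sub u (u + 1))|
   apply: (sub u v)|apply: (sub u v)|apply: (sub u (u + 1))|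
   apply: (sub (v - 1) v)|apply: (sub (v - 1) v)|apply: (sub 0 1)];
  try (move=> y; rewrite in_itv/=); lra.
Qed.

End Jordan.

(** * Vanishing of bracket sums *)

Section Bracket.
Variables (R : realType) (br : R -> int).
Hypothesis C1 : forall x : R, eta br x = eta br (x + 1).

Lemma etaDint x (k : int) : eta br (x + k%:~R) = eta br x.
Proof.
have nat_case (n : nat) (y : R) : eta br (y + n%:R) = eta br y.
  elim: n => [|n IHn]; first by rewrite addr0.
  by rewrite -natr1 addrA -C1.
case: k => n; first exact: nat_case.
by rewrite -(nat_case n.+1) NegzE mulrNz subrK.
Qed.

Hypothesis C3 : forall (x : R) (n : nat), (0 < n)%N ->
  eta br (n%:R * x) <= n%:R * eta br x.

(** By homogeneity each monomial at [n x] is [n^d] times the positive integer [X m], so (C3) applies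
    with [X m] as multiplier. The threshold is uniform in [alpha] and [n]. *)
Lemma brmul_eq0 r d (f : {mpoly int[r]}) (x : 'I_r -> nat) :
  homogeneous d f -> (forall i, (0 < x i)%N) ->
  meval (fun i => (x i)%:Z) f = 0 ->
  exists2 eps : R, 0 < eps & forall (alpha : R) n,
    eta br (alpha * n%:R ^+ d) <= eps ->
    brmul br alpha f (fun i => (n * x i)%N%:R) = 0.
Proof.
move=> /mpoly.dhomogP homf x0 fx0.
pose X (m : 'I_r -> nat) := (\prod_(i < r) x i ^ m i)%N.
pose S : R := \sum_(m <- msupp f) `|mcoeff m f|%:~R * (X m)%:R.
have S0 : 0 <= S by apply: sumr_ge0 => m _; rewrite mulr_ge0.
(* The total error is at most [S * eta br beta <= S / (S + 1) < 1]. *)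
exists (S + 1)^-1 => [|alpha n small]; first by rewrite invr_gt0 ltr_wpDl.
set beta := alpha * n%:R ^+ d in small.
have XE : \sum_(m <- msupp f) (mcoeff m f)%:~R * (X m)%:R = 0 :> R.
  transitivity ((meval (fun i => (x i)%:Z) f)%:~R : R); last by rewrite fx0.
  rewrite mpoly.mevalE rmorph_sum/=; apply: eq_bigr => m _.
  rewrite rmorphM/= !rmorph_prod/=; congr (_ * _).
  by apply: eq_bigr => i _; rewrite natrX rmorphXn.
have brE : brmul br alpha f (fun i => (n * x i)%N%:R) =
    \sum_(m <- msupp f) mcoeff m f * br ((X m)%:R * beta).
  rewrite /brmul big_seq [RHS]big_seq; apply: eq_bigr => m mf.
  congr (_ * br _); rewrite /beta mulrCA; congr (_ * _).
  under eq_bigr do rewrite natrM exprMn.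
  rewrite big_split/= mulrC /X natr_prod; congr (_ * _).
    by apply: eq_bigr => i _; rewrite natrX.
  have <- : mdeg m = d by exact: homf.
  by rewrite mpoly.mdegE -prodrXr.
rewrite brE; set z := (LHS); apply/eqP; rewrite -normr_le0 -ltz1D addr0.
rewrite -(ltr_int R) intr_norm.
(* Subtracting [beta * f(x) = 0] turns the bracket sum into a sum of rounding errors. *)
have -> : z%:~R = \sum_(m <- msupp f) (mcoeff m f)%:~R *
    ((br ((X m)%:R * beta))%:~R - (X m)%:R * beta) :> R.
  under eq_bigr do rewrite mulrBr [X in _ - X]mulrA.
  rewrite sumrB -mulr_suml XE mul0r subr0 /z rmorph_sum/=.
  by apply: eq_bigr => m _; rewrite rmorphM.
apply: (@le_lt_trans _ _ (S * eta br beta)).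
  apply: le_trans (ler_norm_sum _ _ _) _; rewrite /S mulr_suml.
  apply: ler_sum => m _; rewrite normrM -intr_norm -mulrA ler_wpM2l//.
  rewrite distrC; apply: C3.
  by rewrite prodn_gt0// => i; rewrite expn_gt0 x0.
apply: (@le_lt_trans _ _ (S * (S + 1)^-1)); first by rewrite ler_wpM2l.
by rewrite ltr_pdivrMr ?ltr_wpDl// mul1r ltrDl.
Qed.

End Bracket.

(** * Exclusion of constants, and the cases of rational and irrational [alpha] *)

Lemma homogeneous_meval_neq0 r (f : {mpoly int[r]}) (v : 'I_r -> int) :
  homogeneous 0 f -> f != 0 -> meval v f != 0.
Proof.
move=> /mpoly.dhomogP f0 fN0.
have fE : f = mpoly.mpolyC r (mcoeff (mpoly.mnm0) f).
  apply: mpoly.msize1_polyC; rewrite mpoly.mmeasureE big_seq.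
  apply/bigmax_leqP_seq => m mf _; by rewrite (f0 m mf).
by rewrite fE mpoly.mevalC; apply: contraNneq fN0 => c0; rewrite fE c0 mpoly.mpolyC0.
Qed.

Theorem theorem7p1 (R : realType) (br : R -> int)
  (C1 : forall x : R, eta br x = eta br (x + 1))
  (C2 : forall k : int, eta br k%:~R = 0)
  (C3 : forall (x : R) (n : nat), (0 < n)%N ->
     eta br (n%:R * x) <= n%:R * eta br x)
  (C4 : forall t : R, 0 < t ->
     jordan_measurable (eta_sublevel br t) /\
     (0 < jordan_measure (eta_sublevel br t))%E)
  (K r : nat) (K_gt0 : (0 < K)%N) (r_gt0 : (0 < r)%N)
  (f : 'I_K -> {mpoly int[r]})
  (f_neq0 : forall j, f j != 0)
  (f_homog : forall j, exists d : nat, homogeneous d (f j))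
  (x : 'I_r -> nat) (x_gt0 : forall i, (0 < x i)%N)
  (f_root : forall j, meval (fun i => (x i)%:Z) (f j) = 0)
  (alpha : R) :
  (0 < limn_einf (fun N : nat =>
     ((count (fun n => [forall j : 'I_K,
                brmul br alpha (f j) (fun i => (n * x i)%N%:R) == 0 :> int])
             (iota 1 N))%:R / N%:R : R)%R%:E))%E.
Proof.
have [d dP] := choice f_homog.
(* A nonzero constant has no root. Positive degree lets a denominator dividing [n] divide [n^d], and
   matches the exponents [d.+1] of the box. *)
have d_gt0 j : (0 < d j)%N.
  rewrite lt0n; apply/eqP => d0; have := dP j; rewrite d0 => fj0.
  have := homogeneous_meval_neq0 (fun i => (x i)%:Z) fj0 (f_neq0 j).
  by rewrite f_root eqxx.
have /choice[e eP] j : exists e : R, 0 < e /\ forall n,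
    eta br (alpha * n%:R ^+ d j) <= e ->
    brmul br alpha (f j) (fun i => (n * x i)%N%:R) = 0.
  have [e e0 eP] := brmul_eq0 C3 (dP j) x_gt0 (f_root j).
  by exists e; split => // n; exact: eP.
pose eps := \big[Num.min/1]_j e j.
have eps_gt0 : 0 < eps by apply: lt_bigmin => // j _; have [] := eP j.
apply: limn_einf_gt0; set P := (P in pos_lower_density _ P).
have goodP n : (forall j, eta br (alpha * n%:R ^+ d j) <= eps) -> P n.
  move=> small; apply/forallP => j; apply/eqP; have [_] := eP j; apply.
  by apply: le_trans (small j) _; exact: bigmin_le.
have [/rationalP[p [q alphaE]]|alphaI] := pselect (rational alpha).
  (* A denominator 0 means [alpha = 0], as the inverse of 0 is 0. *)
  case: q alphaE => [alphaE|q alphaE].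
    apply: (@pos_lower_density_dvdn _ 1) => // n _; apply: goodP => j.
    by rewrite alphaE invr0 mulr0 mul0r (C2 0) ltW.
  apply: (@pos_lower_density_dvdn _ q.+1) => // n /dvdnP[k nE].
  apply: goodP => j; rewrite [X in eta br X](_ : _ =
    (p * k%:Z * n.+1%:Z ^+ (d j).-1)%:~R); first by rewrite C2 ltW.
  rewrite -[in LHS](prednK (d_gt0 j)) exprS [in X in _ * (X * _)]nE alphaE.
  rewrite !rmorphM/= rmorphXn/=. field.
  by rewrite addrC natr1 pnatr_eq0.
have [jm m_gt0] := C4 _ eps_gt0.
have [a [b [ab abE]]] := jordan_contains_itv jm m_gt0.
(* Passing to the middle third puts the endpoints themselves in the sublevel set, which gives
   [0 <= a'] and [b' < 1]. *)
pose a' := (2 * a + b) / 3; pose b' := (a + 2 * b) / 3.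
have ab' : a' < b' by rewrite /a' /b'; lra.
have sub z : a' <= z <= b' -> eta br z <= eps /\ 0 <= z < 1.
  move=> zab; have : (z \in `]a, b[).
    by rewrite in_itv/=; move: zab; rewrite /a' /b'; lra.
  by move=> /abE[/=]; rewrite !in_itv/= => /andP[].
have [_ /andP[a'0 _]] : eta br a' <= eps /\ 0 <= a' < 1.
  by apply: sub; rewrite lexx ltW.
have [_ /andP[_ b'1]] : eta br b' <= eps /\ 0 <= b' < 1.
  by apply: sub; rewrite lexx ltW.
apply: (@pos_lower_density_box _ alpha a' b' (\max_j d j)) => // n box.
(* Coordinate [d] of the box carries the exponent [d.+1], hence the predecessor. *)
apply: goodP => j; have := box (d j).-1; rewrite !prednK//.
move=> /(_ (leq_bigmax j)) /andP[fa fb].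
have [] := sub (fract (alpha * n.+1%:R ^+ d j)); first by rewrite !ltW.
by rewrite -(etaDint C1 _ (Num.floor (alpha * n.+1%:R ^+ d j))) subrK.
Qed.
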